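(* Let $K$ be an algebraically closed field of characteristic $p > 0$, let $V$ be a $K$-vector space with $\dim V = n$ for some $n \geq 2$, let $G = \operatorname{SL}(V)$, and let $\mathfrak{g} = \mathfrak{sl}(V)$ be its Lie algebra. Let $e \in \mathfrak{g}$ be a nilpotent element whose Jordan normal form on $V$ has block sizes $d_1, \ldots, d_t$ (counted with multiplicity), i.e. $V \downarrow K[e] = J_{d_1}(0) \oplus \cdots \oplus J_{d_t}(0)$, where $t \geq 1$ and $d_r \geq 1$ for all $1 \leq r \leq t$. Set $\alpha = \nu_p(\gcd(d_1, \ldots, d_t))$. Let $e_0$ be the action of $e$ on $\mathfrak{gl}(V)$, let $e_0'$ be the action of $e$ on $\mathfrak{sl}(V)$, and let $e_0''$ be the action of $e$ on $\mathfrak{psl}(V) = \mathfrak{sl}(V)/Z(\mathfrak{sl}(V))$. The Jordan block sizes of $e_0'$ are determined from those of $e_0$ as follows: (i) If $\alpha = 0$, then $r_1(e_0') = r_1(e_0) - 1$ and $r_m(e_0') = r_m(e_0)$ for all $m \neq 1$. (ii) If $\alpha > 0$, then $r_{p^{\alpha}-1}(e_0') = 1$, $r_{p^{\alpha}}(e_0') = r_{p^{\alpha}}(e_0) - 1$, and $r_m(e_0') = r_m(e_0)$ for all $m \neq p^{\alpha}, p^{\alpha}-1$. The Jordan block sizes of $e_0''$ are determined from those of $e_0$ as follows: (iii) If $p \nmid n$, then $r_1(e_0'') = r_1(e_0) - 1$ and $r_m(e_0'') = r_m(e_0)$ for all $m \neq 1$. (iv) If $p \mid n$ and $\alpha = 0$,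 then $r_1(e_0'') = r_1(e_0) - 2$ and $r_m(e_0'') = r_m(e_0)$ for all $m \neq 1$. (v) If $p \mid n$ and $\alpha > 0$, then $r_{p^{\alpha}}(e_0'') = r_{p^{\alpha}}(e_0) - 2$, $r_{p^{\alpha}-1}(e_0'') = 2$, and $r_m(e_0'') = r_m(e_0)$ for all $m \neq p^{\alpha}, p^{\alpha}-1$.
   Context: $J_d(\lambda)$ denotes a $K[T]$-module on which $T$ acts as a single $d \times d$ Jordan block with eigenvalue $\lambda$; $V \downarrow K[e]$ denotes $V$ regarded as a $K[T]$-module with $T$ acting as $e$. For a nilpotent (or unipotent) linear map $f$, $r_m(f)$ is the number of Jordan blocks of size $m$ in the Jordan normal form of $f$ ($m \geq 1$). $\nu_p(a)$ is the largest integer $k \geq 0$ such that $p^k$ divides $a$. The action of $e$ on $\mathfrak{gl}(V)$ is the adjoint one, $x \mapsto ex - xe$ (equivalently, the Lie algebra action on $V \otimes V^* \cong \mathfrak{gl}(V)$); the actions on $\mathfrak{sl}(V)$ and $\mathfrak{psl}(V)$ are the induced ones. $Z(\mathfrak{sl}(V))$ is the centre of $\mathfrak{sl}(V)$, understood as the space of scalar matrices of trace zero. As a $G$-module, $\mathfrak{psl}(V)$ is isomorphic to the irreducible $G$-module $L_G(\varpi_1 + \varpi_{n-1})$ of highest weight $\varpi_1 + \varpi_{n-1}$. *)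

(* Defs.v *)
From HB Require Import structures.
From mathcomp Require Import all_boot all_algebra.
From mathcomp Require classical_sets.

Set Implicit Arguments.
Unset Strict Implicit.
Unset Printing Implicit Defensive.

Import GRing.Theory passmx.
Local Open Scope ring_scope.

Section JordanBlocks.

Variables (K : fieldType) (W : vectType K).
Implicit Types (f : 'End(W)) (s : seq nat).

Definition nilpotent_end f := exists N, forall w, iter N f w = 0.

(* The family c spans a copy of J_(size c)(a): if c is free, the matrix of f  *)
(* on the span of c is the Jordan block with a on the diagonal and 1 just     *)
(* above it.                                                                  *)
Definition jordan_chain f (a : K) (c : seq W) :=
  forall i, (i < size c)%N ->
    f c`_i = a *: c`_i + (if i is j.+1 then c`_j else 0).

(* W = J_{s_1}(0) (+) ... (+) J_{s_t}(0) as a K[T]-module, T acting as f.     *)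
Definition jordan_type f s :=
  exists B : seq (seq W),
    [/\ shape B = s, 0%N \notin s, basis_of fullv (flatten B)
      & forall c, c \in B -> jordan_chain f 0 c].

(* r_m(f) for a nilpotent f. The sequence chosen by xget is a Jordan type of  *)
(* f, unique up to permutation; the default [::] is reached only when f is    *)
(* not nilpotent.                                                             *)
Definition jblocks (m : nat) f : nat :=
  count_mem m (classical_sets.xget [::] (jordan_type f)).

(* The restriction of f to U; only meaningful when f maps U into U, in which  *)
(* case vsproj does not change the value (vrestrE).                           *)
Definition vrestr (U : {vspace W}) f : 'End(subvs_of U) :=
  (linfun (vsproj U) \o f \o linfun vsval)%VF.

Lemma vrestrE (U : {vspace W}) f (u : subvs_of U) :
  (f @: U <= U)%VS -> vsval (vrestr U f u) = f (vsval u).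
Proof.
move=> fU; rewrite /vrestr !comp_lfunE !lfunE /= vsprojK //.
by apply: (subvP fU); apply: memv_img; apply: subvsP.
Qed.

(* The quotient W / Z, realised on the complement Z^C. What makes this a      *)
(* model of the quotient is that vquot_pi is onto with kernel Z.              *)
Definition vquot (Z : {vspace W}) : vectType K := subvs_of (Z^C)%VS.

Definition vquot_pi (Z : {vspace W}) : 'Hom(W, vquot Z) :=
  (linfun (vsproj (Z^C)%VS) \o daddv_pi (Z^C)%VS Z)%VF.

Definition vquot_repr (Z : {vspace W}) : 'Hom(vquot Z, W) := linfun vsval.

(* The map induced by f on W / Z; only meaningful when f maps Z into Z        *)
(* (vquot_endE).                                                              *)
Definition vquot_end (Z : {vspace W}) f : 'End(vquot Z) :=
  (vquot_pi Z \o f \o vquot_repr Z)%VF.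

Lemma vquot_reprK (Z : {vspace W}) (q : vquot Z) :
  vquot_pi Z (vquot_repr Z q) = q.
Proof.
have dj : (Z^C :&: Z = 0)%VS by rewrite capvC capv_compl.
rewrite /vquot_pi /vquot_repr !comp_lfunE !lfunE /=.
by rewrite daddv_pi_id ?subvsP // vsvalK.
Qed.

Lemma limg_vquot_pi (Z : {vspace W}) : limg (vquot_pi Z) = fullv.
Proof.
apply/vspaceP => q; rewrite memvf -[q]vquot_reprK.
by apply/memv_imgP; exists (vquot_repr Z q); rewrite ?memvf.
Qed.

Lemma lker_vquot_pi (Z : {vspace W}) : lker (vquot_pi Z) = Z.
Proof.
have dj : (Z^C :&: Z = 0)%VS by rewrite capvC capv_compl.
have wE w : daddv_pi (Z^C)%VS Z w + daddv_pi Z (Z^C)%VS w = w.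
  by apply: daddv_pi_add; rewrite // addvC addv_complf memvf.
apply/vspaceP => w; rewrite memv_ker /vquot_pi comp_lfunE lfunE /=.
apply/eqP/idP => [pi0 | Zw].
  have /(congr1 vsval) := pi0; rewrite vsprojK ?memv_pi // linear0 => d0.
  by rewrite -[w]wE d0 add0r memv_pi.
have := wE w; rewrite (daddv_pi_id (capv_compl Z) Zw) => /eqP.
by rewrite -subr_eq0 addrK => /eqP ->; rewrite linear0.
Qed.

Lemma vquot_endE (Z : {vspace W}) f (w : W) :
  (f @: Z <= Z)%VS -> vquot_end Z f (vquot_pi Z w) = vquot_pi Z (f w).
Proof.
move=> fZ; apply/eqP.
have -> : vquot_end Z f (vquot_pi Z w)
          = vquot_pi Z (f (vquot_repr Z (vquot_pi Z w))).
  by rewrite /vquot_end comp_lfunE [LHS]comp_lfunE.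
rewrite -subr_eq0 -linearB -memv_ker lker_vquot_pi -linearB.
apply: (subvP fZ); apply: memv_img.
have : vquot_repr Z (vquot_pi Z w) - w \in lker (vquot_pi Z).
  by rewrite memv_ker linearB /= vquot_reprK subrr.
by rewrite lker_vquot_pi.
Qed.

End JordanBlocks.

Section SpecialLinear.

Variables (K : fieldType) (V : vectType K).
Implicit Types e x y : 'End(V).

Definition lfun_trace x : K^o := \tr (mxof (vbasis {:V}) (vbasis {:V}) x).

Lemma lfun_trace_is_linear : linear lfun_trace.
Proof. by move=> a x y; rewrite /lfun_trace !linearP. Qed.

HB.instance Definition _ := GRing.isSemilinear.Build K 'End(V) K^o _ lfun_trace
  (GRing.semilinear_linear lfun_trace_is_linear).

Lemma lfun_traceC x y : lfun_trace (x \o y)%VF = lfun_trace (y \o x)%VF.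
Proof.
have bV := vbasisP {:V}.
by rewrite /lfun_trace !(mxof_comp _ _ bV) mxtrace_mulC.
Qed.

Definition ad_fun e x : 'End(V) := (e \o x)%VF - (x \o e)%VF.

Lemma ad_fun_is_linear e : linear (ad_fun e).
Proof.
move=> a x y; apply/lfunP => v; rewrite /ad_fun.
do !rewrite lfunE /=; rewrite linearP.
by rewrite scalerBr opprD addrACA.
Qed.

HB.instance Definition _ e :=
  GRing.isSemilinear.Build K 'End(V) 'End(V) _ (ad_fun e)
  (GRing.semilinear_linear (ad_fun_is_linear e)).

Definition ad_gl e : 'End('End(V)) := linfun (ad_fun e).

Definition sl : {vspace 'End(V)} := lker (linfun lfun_trace).

Lemma mem_sl x : (x \in sl) = (lfun_trace x == 0).
Proof. by rewrite memv_ker lfunE. Qed.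

Lemma ad_gl_sl e : (ad_gl e @: sl <= sl)%VS.
Proof.
apply/subvP => _ /memv_imgP[x _ ->].
by rewrite mem_sl lfunE /= /ad_fun linearB /= lfun_traceC subrr.
Qed.

Definition ad_sl e : 'End(subvs_of sl) := vrestr sl (ad_gl e).

(* Z(sl(V)): the scalar maps of trace zero, as a subspace of sl(V).           *)
Definition Zsl : {vspace subvs_of sl} :=
  (linfun (@vsval K 'End(V) sl) @^-1: <[\1%VF]>)%VS.

Lemma ad_sl_Zsl e : (ad_sl e @: Zsl <= Zsl)%VS.
Proof.
apply/subvP => _ /memv_imgP[x Zx ->].
suff -> : ad_sl e x = 0 by rewrite mem0v.
apply: subvs_inj; rewrite vrestrE ?ad_gl_sl // lfunE /=.
move: Zx; rewrite -memv_preim lfunE /= => /vlineP[a ->].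
by rewrite linearZ /= /ad_fun comp_lfun1l comp_lfun1r subrr scaler0.
Qed.

Definition psl : vectType K := vquot Zsl.

Definition ad_psl e : 'End(psl) := vquot_end Zsl (ad_sl e).

End SpecialLinear.

Arguments sl {K} V.

(* Main.v *)
(* Write f = ad(e) on gl(V) and q = p^alpha. For m >= 1 the number of blocks  *)
(* of size m of a nilpotent map is 2 k(m) - k(m+1) - k(m-1), where k(j) is    *)
(* the dimension of the kernel of its j-th power. On the Jordan basis of e    *)
(* one writes down w with f^(q-1)(w) = 1, of trace 0 when q > 1, and x with   *)
(* f^q(x) = 0 and tr x <> 0. As tr(f^j(x) y) = +/- tr(x f^j(y)), the trace    *)
(* vanishes on ker f^j exactly when j < q, and 1 is in the image of f^j       *)
(* exactly when j < q. Hence k(j) drops by one, for j >= q only, when passing *)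
(* from gl(V) to sl(V), and, if p divides n, again from sl(V) to psl(V): each *)
(* step replaces one block of size q by one of size q - 1. That gl(V) has no  *)
(* block of size q - 1 >= 1 follows by applying the same to f in place of e:  *)
(* left multiplication by w is a preimage of 1 under ad(f)^(q-1), which       *)
(* forces q to divide all block sizes of f.                                   *)

Require Import Defs.
From HB Require Import structures.
From mathcomp Require Import all_boot all_algebra.
From mathcomp Require Import zify ring.
From mathcomp Require classical_sets.

Set Implicit Arguments.
Unset Strict Implicit.
Unset Printing Implicit Defensive.

Import GRing.Theory passmx.
Local Open Scope ring_scope.

(** The form [tr (x y)] on gl(V) is ad-invariant ([lfun_trace_adC]), so ad(e)^k is self-adjoint up
    to sign. This links two questions: does the trace vanish on ker ad(e)^k (which governs sl(V)),
    and does 1 lie in the image of ad(e)^k (which governs psl(V) when p divides n)? By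
    [lfun_trace_ker_ad], yes to the second gives yes to the first. With q = p^alpha, [ad_preim_id]
    yields yes to both for k < q, as q divides every block size of e; [ad_kernel_trace_neq0] yields
    no to both for k >= q, from a block size not divisible by pq. [dim_lker_ad_sl] and
    [dim_lker_ad_psl_dvd] turn this into kernel dimensions, and [jblocks_dim_lker] into block
    counts. The exact values 1 and 2 for blocks of size q - 1 come from [dvdn_jordan_type_ad]. *)

Section JordanType.

Variables (K : fieldType) (W : vectType K).
Implicit Types (f : 'End(W)) (U : {vspace W}) (s : seq nat) (B : seq (seq W)).

(** * Jordan bases, and block counts from kernels of powers *)

Definition lfun_iter k f : 'End(W) := iter k (comp_lfun f) \1%VF.

Lemma lfun_iterE k f w : lfun_iter k f w = iter k f w.
Proof.
by elim: k => [|k IH]; rewrite /lfun_iter /= ?id_lfunE // comp_lfunE -IH.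
Qed.

Lemma lfun_iterSr k f : lfun_iter k.+1 f = (lfun_iter k f \o f)%VF.
Proof. by apply/lfunP => w; rewrite comp_lfunE !lfun_iterE iterSr. Qed.

Lemma lker_lfun_iterP k f w : reflect (iter k f w = 0) (w \in lker (lfun_iter k f)).
Proof. by rewrite memv_ker lfun_iterE; apply: eqP. Qed.

Lemma free_subseq (X Y : seq W) : subseq X Y -> free Y -> free X.
Proof.
by move=> sXY fY; have /subseq_uniqP/(_ sXY) -> := free_uniq fY; apply: filter_free.
Qed.

Lemma jordan_chain_iter f (c : seq W) k i :
    jordan_chain f 0 c -> (i < size c)%N ->
  iter k f c`_i = if (k <= i)%N then c`_(i - k) else 0.
Proof.
move=> fc ic; elim: k => [|k IH]; first by rewrite subn0.
rewrite iterS IH; case: (leqP k i) => [ki|ik]; last by rewrite linear0 leqNgt ltnW.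
rewrite fc ?(leq_ltn_trans (leq_subr _ _)) // scale0r add0r.
case E: (i - k)%N => [|j]; first by rewrite ltnNge -subn_eq0 E.
by rewrite ltnNge -subn_eq0 E subnS E.
Qed.

Lemma subseq_heads B : [::] \notin B -> subseq [seq head 0 c | c <- B] (flatten B).
Proof.
elim: B => //= -[|x c] B IH; rewrite inE //= => nB.
by rewrite eqxx; apply: subseq_trans (IH nB) _; apply: suffix_subseq.
Qed.

Lemma subseq_takes (h : seq W -> nat) B :
  subseq (flatten [seq take (h c) c | c <- B]) (flatten B).
Proof. by elim: B => //= c B IH; apply: cat_subseq; rewrite ?take_subseq. Qed.

Lemma limg_proper_nilpotent f U :
  nilpotent_end f -> (f @: U <= U)%VS -> U != 0%VS -> (\dim (f @: U) < \dim U)%N.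
Proof.
move=> [N fN0] fU U0; rewrite ltnNge; apply: contra U0 => leUf.
have fUU : (f @: U = U)%VS by apply/eqP; rewrite eqEdim fU.
have {leUf} UN k : (lfun_iter k f @: U = U)%VS.
  by elim: k => [|k IH]; rewrite ?limg_comp ?lim1g // IH.
apply/eqP; rewrite -(UN N); apply/eqP; rewrite -subv0.
by apply/subvP => _ /memv_imgP[w _ ->]; rewrite lfun_iterE fN0 mem0v.
Qed.

(* A Jordan basis of f(U) becomes one of U by prolonging each chain with a    *)
(* preimage of its last vector and adding vectors that complete the first     *)
(* vectors of the chains to a basis of ker f.                                 *)
Lemma jordan_basis_nilpotent f U :
    nilpotent_end f -> (f @: U <= U)%VS ->
  exists B, [/\ [::] \notin B, basis_of U (flatten B)
              & forall c, c \in B -> jordan_chain f 0 c].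
Proof.
move=> fnil; have [m] := ubnP (\dim U); elim: m U => // m IHm U leUm fU.
have [->|U0] := eqVneq U 0%VS; first by exists [::]; rewrite nil_basis.
have ltfU := limg_proper_nilpotent fnil fU U0.
have [|//|B [nB bB cB]] := IHm (f @: U)%VS.
- exact: leq_trans ltfU _.
- exact: limgS.
pose g := (projv U \o (f \o projv U)^-1)%VF.
have gU y : g y \in U by rewrite comp_lfunE memv_proj.
have fg y : y \in (f @: U)%VS -> f (g y) = y.
  move=> fUy; rewrite !comp_lfunE.
  have -> z : f (projv U z) = (f \o projv U)%VF z by rewrite comp_lfunE.
  by rewrite limg_lfunVK // limg_comp limg_proj.
pose bots := [seq head 0 c | c <- B].
have sbots := subseq_heads nB.
have fbots : free bots := free_subseq sbots (basis_free bB).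
pose kU := (U :&: lker f)%VS.
have BU c v : c \in B -> v \in c -> v \in (f @: U)%VS.
  by move=> Bc cv; apply: (basis_mem bB); apply/flattenP; exists c.
have botsk : (<<bots>> <= kU)%VS.
  apply/span_subvP => _ /mapP[c Bc ->].
  case: c Bc => [|x c] Bc; first by rewrite (negPf nB) in Bc.
  rewrite memv_cap (subvP fU) ?(BU _ _ Bc) ?mem_head //= memv_ker.
  by have := cB _ Bc 0%N isT; rewrite /= scale0r addr0 => ->.
pose X := vbasis (kU :\: <<bots>>).
pose B1 := [seq rcons c (g (last 0 c)) | c <- B]; pose B2 := [seq [:: v] | v <- X].
have B1P c v : c \in B -> v \in rcons c (g (last 0 c)) -> v \in <<flatten (B1 ++ B2)>>%VS.
  move=> Bc cv; apply: memv_span; rewrite flatten_cat mem_cat.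
  by apply/orP; left; apply/flattenP; exists (rcons c (g (last 0 c))) => //; apply: map_f.
have fX : flatten B2 = X by rewrite /B2; elim: (tval X) => //= v ? ->.
have chn c : c \in B -> jordan_chain f 0 (rcons c (g (last 0 c))).
  move=> Bc i; rewrite size_rcons ltnS leq_eqVlt !nth_rcons => /orP[/eqP ->|ic].
    have c0 : (0 < size c)%N by rewrite lt0n size_eq0; apply: contraNneq nB => <-.
    rewrite ltnn eqxx scale0r add0r fg; last first.
      by apply: (BU c) => //; case: (c) c0 => //= *; rewrite mem_last.
    case: (c) c0 => // x c' _.
    by rewrite -[RHS]/((rcons (x :: c') _)`_(size c')) nth_rcons ltnSn (last_nth 0).
  rewrite ic cB //; congr (_ + _); case: i ic => // j jc.
  by rewrite nth_rcons (ltnW jc).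
have span_fB : (<<flatten B>> <= f @: <<flatten (B1 ++ B2)>>)%VS.
  apply/span_subvP => v /flattenP[c Bc /(nthP 0)[i ic <-]].
  have := chn c Bc i.+1; rewrite size_rcons ltnS => /(_ ic).
  rewrite scale0r add0r [(rcons _ _)`_i]nth_rcons ic => <-; apply: memv_img.
  by apply: (B1P c); rewrite // mem_nth // size_rcons.
exists (B1 ++ B2); split.
- rewrite mem_cat negb_or; apply/andP; split; apply/negP => /mapP[c _] //.
  by case: c.
- have subU : (<<flatten (B1 ++ B2)>> <= U)%VS.
    apply/span_subvP => v; rewrite flatten_cat fX mem_cat => /orP[].
      case/flattenP=> _ /mapP[c Bc ->]; rewrite mem_rcons inE => /orP[/eqP ->//|cv].
      by apply: (subvP fU); apply: BU cv.
    move/vbasis_mem => Xv; apply: subvP Xv.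
    exact: subv_trans (diffvSl _ _) (capvSl _ _).
  rewrite basisEdim; apply/andP; split.
    apply/subvP => w Uw.
    have : f w \in (f @: <<flatten (B1 ++ B2)>>)%VS.
      by apply: (subvP span_fB); rewrite (span_basis bB) memv_img.
    case/memv_imgP => u Bu fwu.
    suff : w - u \in <<flatten (B1 ++ B2)>>%VS by move=> /memvD/(_ Bu); rewrite subrK.
    have : w - u \in kU.
      by rewrite memv_cap memv_ker linearB /= fwu subrr eqxx memvB ?(subvP subU u Bu).
    rewrite -(addv_diff_cap kU <<bots>>); case/memv_addP => a Xa [b]; rewrite memv_cap.
    case/andP=> _ bb ->; rewrite memvD //.
      apply: subvP Xa; rewrite flatten_cat fX span_cat (span_basis (vbasisP _)).
      exact: addvSr.
    apply: subvP bb; apply/span_subvP => _ /mapP[c Bc ->]; apply: (B1P c) => //.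
    case: c Bc => [|x c] Bc; first by rewrite (negPf nB) in Bc.
    by rewrite inE eqxx.
  rewrite flatten_cat fX size_cat size_tuple.
  have -> : size (flatten B1) = (size (flatten B) + size B)%N.
    rewrite /B1; elim: (B) => //= c B' IH.
    by rewrite !size_cat IH size_rcons; lia.
  have := size_basis (X := in_tuple (flatten B)) bB; rewrite /= => <-.
  have := dimv_cap_compl kU <<bots>>; rewrite (capv_idPr botsk).
  have /eqP -> := fbots; rewrite size_map => dk.
  by rewrite -(limg_ker_dim f U) -/kU -dk -addnA addnC.
- move=> c; rewrite mem_cat => /orP[/mapP[c' Bc' ->]|/mapP[v Xv ->]]; first exact: chn.
  case=> //= _; rewrite scale0r addr0; apply/eqP; rewrite -memv_ker.
  apply: subvP (vbasis_mem Xv).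
  exact: subv_trans (diffvSl _ _) (capvSr _ _).
Qed.

Lemma jordan_type_nilpotent f : nilpotent_end f -> exists s, jordan_type f s.
Proof.
move=> fnil; have [B [nB bB cB]] := jordan_basis_nilpotent fnil (subvf (f @: fullv)).
exists (shape B); exists B; split=> //.
by apply: contra nB => /mapP[c Bc /esym/eqP]; rewrite size_eq0 => /eqP <-.
Qed.

Lemma jordan_type_jblocks f :
  nilpotent_end f -> jordan_type f (classical_sets.xget [::] (jordan_type f)).
Proof. by move/jordan_type_nilpotent; apply: classical_sets.xgetPex. Qed.

Lemma dim_jordan_type f s : jordan_type f s -> \dim {:W} = sumn s.
Proof.
case=> B [<- _ bB _]; have := size_basis (X := in_tuple (flatten B)) bB.
by rewrite /= size_flatten.
Qed.

Lemma dim_limg_lfun_iter f s k :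
  jordan_type f s -> \dim (limg (lfun_iter k f)) = sumn [seq (l - k)%N | l <- s].
Proof.
case=> B [<- _ bB cB].
pose Y := flatten [seq take (size c - k) c | c <- B].
have fY : free Y := free_subseq (subseq_takes _ _) (basis_free bB).
have -> : limg (lfun_iter k f) = <<Y>>%VS.
  rewrite -(span_basis bB); apply/eqP; rewrite eqEsubv limg_span; apply/andP; split.
    apply/span_subvP => _ /mapP[v /flattenP[c Bc /(nthP 0)[i ic <-]] ->].
    rewrite lfun_iterE (jordan_chain_iter _ (cB c Bc)) //.
    case: leqP => ki; last exact: mem0v.
    apply: memv_span; apply/flattenP; exists (take (size c - k) c); first exact: map_f.
    have ik : (i - k < size c - k)%N by rewrite ltn_sub2r // (leq_ltn_trans ki).
    by rewrite -(nth_take _ ik) mem_nth // size_takel // leq_subr.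
  apply/span_subvP => v /flattenP[_ /mapP[c Bc ->]] /(nthP 0)[i].
  rewrite size_takel ?leq_subr // => ic <-; rewrite nth_take //; apply: memv_span.
  have ikc : (i + k < size c)%N by rewrite addnC -ltn_subRL.
  apply/mapP; exists c`_(i + k); first by apply/flattenP; exists c; rewrite // mem_nth.
  rewrite lfun_iterE (jordan_chain_iter _ (cB c Bc)) //.
  by rewrite leq_addl addnK.
rewrite (eqP fY) size_flatten /shape -!map_comp; congr sumn; apply: eq_map => c /=.
by rewrite size_takel // leq_subr.
Qed.

Lemma dim_lker_lfun_iter f s k :
  jordan_type f s -> \dim (lker (lfun_iter k f)) = sumn [seq minn k l | l <- s].
Proof.
move=> fs; have := limg_ker_dim (lfun_iter k f) fullv.
rewrite capfv (dim_limg_lfun_iter k fs) (dim_jordan_type fs) => e.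
have : (sumn [seq minn k l | l <- s] + sumn [seq (l - k)%N | l <- s] = sumn s)%N.
  by elim: (s) => //= l s' <-; lia.
lia.
Qed.

(** A block of size l contributes min(k, l) to dim ker f^k; the second difference of this in k, at
    m, is -1 if l = m and 0 otherwise. *)
Lemma count_jordan_type f s m : jordan_type f s -> (0 < m)%N ->
  (count_mem m s + \dim (lker (lfun_iter m.+1 f)) + \dim (lker (lfun_iter m.-1 f))
    = (\dim (lker (lfun_iter m f))).*2)%N.
Proof.
move=> fs m0; rewrite !(dim_lker_lfun_iter _ fs).
by elim: (s) => //= l s' IH; case: eqP => lm; lia.
Qed.

Lemma jblocks_dim_lker f m : nilpotent_end f -> (0 < m)%N ->
  (jblocks m f + \dim (lker (lfun_iter m.+1 f)) + \dim (lker (lfun_iter m.-1 f))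
    = (\dim (lker (lfun_iter m f))).*2)%N.
Proof. by move=> /jordan_type_jblocks; apply: count_jordan_type. Qed.

End JordanType.

Arguments lfun_iter {K W} k f : simpl never.

(** * The trace form and the adjoint action *)

Section Trace.

Variables (K : fieldType) (V : vectType K).
Implicit Types e x y w : 'End(V).

Lemma lfun_trace_basis n (b : n.-tuple V) x : basis_of {:V} b ->
  lfun_trace x = \sum_(i < n) coord b i (x b`_i).
Proof.
move=> bb; have bn := size_basis bb; case: n / bn b bb => b bb; have tv := vbasisP {:V}.
rewrite /lfun_trace -[x in mxof _ _ x]comp_lfun1r (mxof_comp _ _ bb) mxtrace_mulC.
rewrite -(mxof_comp _ _ tv) comp_lfun1l; apply: eq_bigr => i _.
by rewrite mxE /= vecof_delta -coord_rVof.
Qed.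

Lemma iter_ad0 e k : iter k (ad_fun e) 0 = 0.
Proof. by elim: k => //= k ->; rewrite linear0. Qed.

Lemma iter_ad_gl e k x : iter k (ad_gl e) x = iter k (ad_fun e) x.
Proof. by elim: k => //= k ->; rewrite lfunE. Qed.

Lemma lfun_trace_adC e x y :
  lfun_trace (ad_fun e x \o y)%VF = - lfun_trace (x \o ad_fun e y)%VF.
Proof.
rewrite /ad_fun comp_lfunDl comp_lfunDr !linearD /= comp_lfunNl comp_lfunNr !linearN /=.
by rewrite opprK addrC !comp_lfunA -[in X in _ + X]comp_lfunA [X in _ + X]lfun_traceC.
Qed.

Lemma lfun_trace_iter_adC e k x y :
  lfun_trace (iter k (ad_fun e) x \o y)%VF
    = (-1) ^+ k * lfun_trace (x \o iter k (ad_fun e) y)%VF.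
Proof.
elim: k y => [|k IH] y; first by rewrite mul1r.
by rewrite iterS lfun_trace_adC IH -iterSr exprS mulN1r mulNr.
Qed.

(* If ad(e)^k w = 1, then tr x = tr (x ad(e)^k w) = +/- tr (ad(e)^k x w).     *)
Lemma lfun_trace_ker_ad e k w x :
  iter k (ad_fun e) w = \1%VF -> iter k (ad_fun e) x = 0 -> lfun_trace x = 0.
Proof.
move=> ew ex; have := lfun_trace_iter_adC e k x w.
rewrite ex ew comp_lfun0l comp_lfun1r linear0 => /esym/eqP.
by rewrite mulf_eq0 signr_eq0 => /eqP.
Qed.

Lemma ad_nilpotent e : nilpotent_end e -> nilpotent_end (ad_gl e).
Proof.
case=> N eN0.
have eN k : (N <= k)%N -> lfun_iter k e = 0.
  move=> /subnKC <-; apply/lfunP => v; rewrite lfun_iterE lfunE /= addnC iterD eN0.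
  by elim: (_ - _)%N => //= m ->; rewrite linear0.
exists N.*2 => x.
(* Each application of ad(e) raises one of the two exponents by 1, so once they total 2N one of them
   is at least N. *)
suff H k a b : (N.*2 <= k + a + b)%N ->
    iter k (ad_gl e) (lfun_iter a e \o x \o lfun_iter b e)%VF = 0.
  by rewrite -(H N.*2 0 0)%N ?addn0 // comp_lfun1l comp_lfun1r.
elim: k a b => [|k IH] a b le.
  have [/eN ->|/eN ->] : (N <= a)%N \/ (N <= b)%N by lia.
    by rewrite /= !comp_lfun0l.
  by rewrite /= comp_lfun0r.
rewrite iterSr lfunE /=.
have -> : ad_fun e (lfun_iter a e \o x \o lfun_iter b e)%VF
    = (lfun_iter a.+1 e \o x \o lfun_iter b e)%VF
      - (lfun_iter a e \o x \o lfun_iter b.+1 e)%VF.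
  by rewrite /ad_fun (lfun_iterSr b) !comp_lfunA.
by rewrite -lfun_iterE linearB /= !lfun_iterE !IH ?subrr //; lia.
Qed.

End Trace.

(** * Binomial coefficients modulo p *)

Lemma dvdn_bin_pfactor p a j :
  prime p -> (0 < j < p ^ a)%N -> (p %| 'C(p ^ a, j))%N.
Proof.
move=> pp /andP[j0 ja]; apply: contraLR ja => npC; rewrite -leqNgt.
have co : coprime (p ^ a) 'C(p ^ a, j) by rewrite coprimeXl // prime_coprime.
case: j j0 co {npC} => // j _ co; apply: dvdn_leq => //.
by rewrite -(Gauss_dvdl _ co) -mul_bin_diag dvdn_mulr.
Qed.

(** By Pascal's rule consecutive coefficients sum to C(p^a, r+1), which is 0 in K, so they are
    opposite. Hence every coefficient in the expansion of ad(e)^(p^a-1) is 1. *)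
Lemma signed_bin_pred_pfactor (K : fieldType) p a r : p \in [pchar K] -> (r < p ^ a)%N ->
  (-1) ^+ r * 'C((p ^ a).-1, r)%:R = 1 :> K.
Proof.
move=> Kp; have pp := pcharf_prime Kp.
elim: r => [|r IH] ra; first by rewrite bin0 mulr1.
have /(dvdn_bin_pfactor pp) : (0 < r.+1 < p ^ a)%N by [].
rewrite -(prednK (leq_trans (ltn0Sn _) ra)) binS (dvdn_pcharf Kp) natrD addr_eq0.
rewrite prednK ?(leq_trans _ ra) // => /eqP ->.
by rewrite exprS mulN1r mulrNN IH // ltnW.
Qed.

Lemma sum_dvdn_lt q a m : (0 < q)%N ->
  (\sum_(i < a * q + m) ((i < a * q) && (q %| i)) = a)%N.
Proof.
move=> q0; rewrite big_split_ord /= [X in (_ + X)%N]big1 => [|i _]; last first.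
  by rewrite ltnNge leq_addr.
have H n : (\sum_(i < n) (q %| i) = (n + q.-1) %/ q)%N.
  elim: n => [|n IH]; first by rewrite big_ord0 divn_small // prednK.
  rewrite big_ord_recr /= IH addSn divnS // -addnS prednK // dvdn_addl //.
  exact: addnC.
rewrite addn0; transitivity (\sum_(i < a * q) (q %| i))%N.
  by apply: eq_bigr => i _; rewrite ltn_ord.
by rewrite H divnMDl // divn_small ?addn0 ?prednK.
Qed.

(** * Iterating ad(e) along Jordan chains *)

Section Chains.

Variables (K : fieldType) (V : vectType K).
Implicit Types e x y w : 'End(V).

Lemma lfun_of_free (b : seq V) (F : nat -> V) : free b ->
  exists x : 'End(V), forall i, (i < size b)%N -> x b`_i = F i.
Proof.
move=> fb; have [f /(_ fb)] := linear_of_free b (mkseq F (size b)).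
rewrite size_mkseq => /(_ erefl) fF; exists (linfun f) => i ib.
by rewrite lfunE /= -(nth_map _ 0) // fF nth_mkseq.
Qed.

Lemma lfun_eq_basis (b : seq V) x y : basis_of {:V} b ->
  (forall v, v \in b -> x v = y v) -> x = y.
Proof.
move=> bb xy; apply/lfunP => v; apply/eqP; rewrite -subr_eq0.
suff : (fullv <= lker (x - y)%R)%VS.
  by move/subvP/(_ v (memvf v)); rewrite memv_ker add_lfunE opp_lfunE.
rewrite -(span_basis bb); apply/span_subvP => u /xy xyu.
by rewrite memv_ker add_lfunE opp_lfunE xyu subrr.
Qed.

(* A concatenation of Jordan chains whose lengths are divisible by q: e       *)
(* lowers the index by one, except at some multiples of q, where it vanishes. *)
Definition stepped q e (c : seq V) := forall i, (i < size c)%N ->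
  (0 < i)%N && (e c`_i == c`_i.-1) || (q %| i)%N && (e c`_i == 0).

Lemma stepped_jordan_chain q e c : jordan_chain e 0 c -> stepped q e c.
Proof.
move=> ec i ic; rewrite ec // scale0r add0r.
by case: i ic => [|i] ic; rewrite /= ?dvdn0 eqxx.
Qed.

(** As q divides all lengths, each chain starts at a multiple of q in the concatenation, which is
    where [stepped] allows e to vanish. *)
Lemma stepped_flatten q e (B : seq (seq V)) :
    (forall c, c \in B -> jordan_chain e 0 c) -> all (dvdn q) (shape B) ->
  stepped q e (flatten B).
Proof.
elim: B => [|c B IH] //= eB /andP[qc qB] i.
rewrite size_cat => ic; rewrite !nth_cat; case: (ltnP i (size c)) => [ltic|leic].
  rewrite (leq_ltn_trans (leq_pred i) ltic).
  exact: (stepped_jordan_chain q (eB c (mem_head _ _)) ltic).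
have /IH/(_ qB) st : forall c', c' \in B -> jordan_chain e 0 c'.
  by move=> c' Bc'; apply: eB; rewrite inE Bc' orbT.
have := st (i - size c)%N; rewrite ltn_subLR // => /(_ ic).
have -> : (q %| i - size c)%N = (q %| i)%N by rewrite -{2}(subnK leic) dvdn_addl.
case/orP => /andP[h eci]; last by rewrite h eci orbT.
rewrite subn_gt0 in h; rewrite (leq_trans _ h) // ltnNge -ltnS (ltn_predK h) h /=.
by rewrite -subn1 subnAC subn1 eci.
Qed.

(** Expand ad(e)^k x as the sum of (-1)^j C(k,j) e^(k-j) x e^j. Since x kills the vectors at
    non-multiples of q and k < q, only j = r := i mod q survives at index i; [y k i] stands for
    e^(k-r) x c_(i-r). *)
Lemma iter_ad_stepped q e x (c : seq V) (y : nat -> nat -> V) :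
    (0 < q)%N -> stepped q e c ->
    (forall i, (i < size c)%N -> x c`_i = if (q %| i)%N then y 0 i else 0) ->
    (forall k i, (i < size c)%N -> (k.+1 < q)%N -> (i %% q <= k)%N ->
      e (y k i) = y k.+1 i) ->
    (forall k i, (i < size c)%N -> ~~ (q %| i)%N -> y k i.-1 = y k.+1 i) ->
  forall k i, (k < q)%N -> (i < size c)%N ->
    iter k (ad_fun e) x c`_i = ((-1) ^+ (i %% q) * 'C(k, i %% q)%:R) *: y k i.
Proof.
move=> q0 stc xc ey yP; elim=> [|k IH] i kq ic.
  rewrite /= xc //; case: ifPn => [/eqP ->|]; first by rewrite bin0 mulr1 scale1r.
  by rewrite /dvdn; case: (i %% q)%N => // r _; rewrite bin0n mulr0 scale0r.
have IHi := IH _ (ltnW kq).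
rewrite iterS [LHS]add_lfunE opp_lfunE !comp_lfunE IHi // linearZ /=.
have -> : ((-1) ^+ (i %% q) * 'C(k, i %% q)%:R) *: e (y k i)
    = ((-1) ^+ (i %% q) * 'C(k, i %% q)%:R) *: y k.+1 i.
  by case: (leqP (i %% q) k) => [/ey ->//|/bin_small ->]; rewrite mulr0 !scale0r.
have i1c : (i.-1 < size c)%N := leq_ltn_trans (leq_pred i) ic.
case: (boolP (q %| i)%N) => [qi|nqi].
  (* Index i - 1 has residue q - 1 > k, so its binomial coefficient is 0. *)
  have -> : iter k (ad_fun e) x (e c`_i) = 0.
    have /orP[/andP[i0 /eqP ->]|/andP[_ /eqP ->]] := stc i ic; last by rewrite linear0.
    rewrite IHi // modn_pred // ?qi; last by case: (q) kq => [|[]].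
    by rewrite bin_small ?mulr0 ?scale0r //; lia.
  by rewrite (eqP qi) !bin0 subr0.
have /orP[/andP[i0 /eqP ->]|] := stc i ic; last by rewrite (negPf nqi).
rewrite IHi // modn_pred //; last by case: (q) kq => [|[]].
rewrite (negPf nqi) yP // -scalerBl; congr (_ *: _).
move: nqi; rewrite /dvdn; case: (i %% q)%N => // r _ /=.
by rewrite binS natrD exprS; ring.
Qed.

End Chains.

(** * The two witnesses: x with nonzero trace, w above the identity *)

Section AdjointPowers.

Variables (K : fieldType) (V : vectType K) (p : nat).
Hypothesis Kp : p \in [pchar K].
Implicit Types e x y w : 'End(V).

(* x is the projection, along the other chains, onto the span of every p^a-th *)
(* vector of a chain of length l; it commutes with e^(p^a), and its trace is  *)
(* l / p^a.                                                                   *)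
Lemma ad_kernel_trace_neq0 e s l a : jordan_type e s -> l \in s ->
    (p ^ a %| l)%N -> ~~ (p ^ a.+1 %| l)%N ->
  exists x, iter (p ^ a) (ad_fun e) x = 0 /\ lfun_trace x != 0.
Proof.
move=> [B [<- _ bB eB]] /mapP[c Bc ->] qc nc.
set q := (p ^ a)%N in qc *.
have q0 : (0 < q)%N by rewrite expn_gt0 prime_gt0 // (pcharf_prime Kp).
pose X := flatten (rem c B); pose b := c ++ X.
have pb : perm_eq (flatten B) b by apply: perm_flatten (perm_to_rem Bc).
have bb : basis_of fullv b by rewrite -(perm_basis _ pb).
have [x xb] := lfun_of_free (fun i => if (i < size c)%N && (q %| i)%N then b`_i else 0)
  (basis_free bb).
have cb i : (i < size c)%N -> c`_i = b`_i by move=> ic; rewrite nth_cat ic.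
have xc i : (i < size c)%N -> x c`_i = if (q %| i)%N then c`_i else 0.
  by move=> ic; rewrite cb // xb ?size_cat ?ltn_addr ?ic.
have xX v : v \in X -> x v = 0.
  move=> /(nthP 0)[i iX <-]; have -> : X`_i = b`_(size c + i).
    by rewrite nth_cat ltnNge leq_addr /= addKn.
  by rewrite xb ?size_cat ?ltn_add2l // ltnNge leq_addr.
have eX v : v \in X -> e v = 0 \/ e v \in X.
  case/flattenP=> c' Bc' /(nthP 0)[i ic <-].
  rewrite (eB _ (mem_rem Bc')) // scale0r add0r.
  case: i ic => [|i] ic; [by left | right].
  by apply/flattenP; exists c'; rewrite // mem_nth // ltnW.
have stc := stepped_jordan_chain q (eB c Bc).
(* On c, ad(e)^(q-1) x is therefore e^(q-1), which commutes with e; this makes ad(e)^q x vanish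
   there. *)
have xq i : (i < size c)%N -> iter q.-1 (ad_fun e) x c`_i = iter q.-1 e c`_i.
  move=> ic; rewrite (iter_ad_stepped (y := fun k j => iter k e c`_j) q0 stc) ?prednK //.
    by rewrite signed_bin_pred_pfactor // ?scale1r // ltn_pmod.
  move=> k j jc qj; rewrite iterSr; have /orP[/andP[_ /eqP ->//]|] := stc j jc.
  by rewrite (negPf qj).
exists x; split.
  apply: (lfun_eq_basis bb) => v; rewrite lfunE /= mem_cat => /orP[|Xv]; last first.
    elim: q {xb xc xq qc q0 stc} v Xv => [|k IH] v Xv; first exact: xX.
    rewrite iterS [LHS]add_lfunE opp_lfunE !comp_lfunE IH // linear0 add0r.
    by case: (eX v Xv) => [->|/IH ->]; rewrite ?linear0 ?oppr0.
  case/(nthP 0)=> i ic <-; rewrite -(prednK q0) iterS [LHS]add_lfunE opp_lfunE !comp_lfunE.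
  rewrite xq // -iterS iterSr; have /orP[/andP[_ /eqP ->]|/andP[_ /eqP ->]] := stc i ic.
    by rewrite xq ?subrr // (leq_ltn_trans (leq_pred i)).
  by rewrite linear0 subr0 -lfun_iterE linear0.
rewrite (lfun_trace_basis (b := in_tuple b) _ bb).
have -> : \sum_(i < size b) coord (in_tuple b) i (x b`_i)
    = (\sum_(i < size b) ((i < size c) && (q %| i))%N)%:R.
  rewrite natr_sum; apply: eq_bigr => i _; rewrite xb //; case: ifP => _.
    by rewrite (coord_free (X := in_tuple b)) ?eqxx // (basis_free bb).
  by rewrite linear0.
have [m cm] := dvdnP qc.
rewrite size_cat cm sum_dvdn_lt // -(dvdn_pcharf Kp).
by apply: contra nc => pm; rewrite cm expnS -/q dvdn_mul.
Qed.

(* On each chain of e, w raises the index by p^a - 1 at the multiples of p^a  *)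
(* and vanishes elsewhere.                                                    *)
Lemma ad_preim_id e s a : jordan_type e s -> all (dvdn (p ^ a)) s ->
  exists w, iter (p ^ a).-1 (ad_fun e) w = \1%VF /\ ((0 < a)%N -> lfun_trace w = 0).
Proof.
move=> [B [<- _ bB eB]] qB; have pp := pcharf_prime Kp.
set q := (p ^ a)%N in qB *; set b := flatten B in bB.
have q0 : (0 < q)%N by rewrite expn_gt0 prime_gt0.
have stb : stepped q e b := stepped_flatten eB qB.
have qb : (q %| size b)%N.
  rewrite size_flatten; elim: (shape B) qB => //= l s' IH /andP[ql /IH].
  exact: dvdn_add.
have lt_up k i : (i < size b)%N -> (i %% q <= k)%N -> (i + q.-1 - k < size b)%N.
  move=> ib ik; have [m bm] := dvdnP qb.
  have : (i %/ q < m)%N by rewrite ltn_divLR // -bm.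
  have := divn_eq i q; have := ltn_pmod i q0; rewrite bm; nia.
have [w wb] := lfun_of_free (fun i => if (q %| i)%N then b`_(i + q.-1) else 0)
  (basis_free bB).
exists w; split.
  apply: (lfun_eq_basis bB) => v /(nthP 0)[i ib <-]; rewrite id_lfunE.
  rewrite (iter_ad_stepped (y := fun k j => b`_(j + q.-1 - k)) q0 stb) ?prednK //.
  - by rewrite addnK signed_bin_pred_pfactor // ?scale1r // ltn_pmod.
  - by move=> j jb; rewrite wb // subn0.
  - move=> k j jb kq jk; have := stb _ (lt_up k j jb jk).
    case/orP => [/andP[_ /eqP ->]|/andP[qj _]]; first by rewrite -subnS.
    (* The residue of this index is j mod q + q - 1 - k, strictly between 0 and q, so e does lower
       the index. *)
    have e1 : (j + q.-1 - k = j %/ q * q + (j %% q + q.-1 - k))%N.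
      by have := divn_eq j q; lia.
    move: qj; rewrite e1 dvdn_addr ?dvdn_mull // => /dvdn_leq.
    by have := ltn_pmod j q0; lia.
  move=> k j jb qj; congr (b`_ _); case: j jb qj => [|j] _; first by rewrite dvdn0.
  by move=> _; lia.
case: (posnP a) => // a0 _.
(* For q > 1, w shifts indices by q - 1 > 0, so its diagonal is zero. *)
have q1 : (1 < q)%N by rewrite -(exp1n a) ltn_exp2r // prime_gt1.
rewrite (lfun_trace_basis (b := in_tuple b) _ bB) big1 // => i _; rewrite wb //.
case: ifP => qi; last by rewrite linear0.
have ui : (i + q.-1 < size b)%N.
  by have := lt_up 0%N i (ltn_ord i); rewrite subn0 (eqP qi); apply.
rewrite (coord_free (X := in_tuple b) (Ordinal ui)) ?(basis_free bB) //.
by rewrite -val_eqE /=; case: eqP => //; lia.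
Qed.

End AdjointPowers.

(** * Block sizes of ad(e) are divisible by q *)

Section LeftMultiplication.

Variables (K : fieldType) (V : vectType K).
Implicit Types e x y w : 'End(V).

Definition lmul w x : 'End(V) := (w \o x)%VF.

Lemma lmul_is_linear w : linear (lmul w).
Proof. by move=> c x y; rewrite /lmul comp_lfunDr comp_lfunZr. Qed.

HB.instance Definition _ w :=
  GRing.isSemilinear.Build K 'End(V) 'End(V) _ (lmul w)
  (GRing.semilinear_linear (lmul_is_linear w)).

(** The commutator of ad(e) with left multiplication by w is left multiplication by [e, w]. *)
Lemma iter_ad_lmul e w k :
  iter k (ad_fun (ad_gl e)) (linfun (lmul w)) = linfun (lmul (iter k (ad_fun e) w)).
Proof.
elim: k => //= k ->; apply/lfunP => x.
rewrite add_lfunE opp_lfunE !comp_lfunE !lfunE /= /lmul /ad_fun.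
rewrite comp_lfunDl comp_lfunDr !comp_lfunNl !comp_lfunNr !comp_lfunA opprB.
by rewrite addrA subrK.
Qed.

(* If w is a preimage of the identity of V under ad(e)^(p^a-1), then left     *)
(* multiplication by w is one of the identity of gl(V) under                  *)
(* ad(ad e)^(p^a-1); by [ad_kernel_trace_neq0] this excludes block sizes of   *)
(* ad e that are not divisible by p^a.                                        *)
Lemma dvdn_jordan_type_ad p e s s' a : p \in [pchar K] ->
    jordan_type e s -> jordan_type (ad_gl e) s' ->
  all (dvdn (p ^ a)) s -> all (dvdn (p ^ a)) s'.
Proof.
move=> Kp es es' qs; have pp := pcharf_prime Kp.
have [w [ew _]] := ad_preim_id Kp es qs.
have idw : iter (p ^ a).-1 (ad_fun (ad_gl e)) (linfun (lmul w)) = \1%VF.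
  by rewrite iter_ad_lmul ew; apply/lfunP => x; rewrite !lfunE /= /lmul comp_lfun1l.
apply/allP => l s'l; apply: contraT => nql.
have l0 : (0 < l)%N.
  by case: es' => B [_ + _ _]; case: (l) s'l => // ->.
have va : (logn p l < a)%N by rewrite ltnNge -pfactor_dvdn.
have [x [xk]] := ad_kernel_trace_neq0 Kp es' s'l (pfactor_dvdnn p l)
  ltac:(by rewrite pfactor_dvdn // ltnn).
apply: contraNT => _; apply/eqP; apply: (lfun_trace_ker_ad idw).
have /subnK <- : (p ^ logn p l <= (p ^ a).-1)%N.
  by rewrite -ltnS prednK ?expn_gt0 ?prime_gt0 // ltn_exp2l // prime_gt1.
by rewrite iterD xk iter_ad0.
Qed.

End LeftMultiplication.

(** * Kernels of powers on invariant subspaces and quotients *)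

Section SubQuotientKernels.

Variables (K : fieldType) (W : vectType K).

Lemma iter_vrestr (U : {vspace W}) f k u : (f @: U <= U)%VS ->
  vsval (iter k (vrestr U f) u) = iter k f (vsval u).
Proof. by move=> fU; elim: k => //= k <-; rewrite vrestrE. Qed.

Lemma nilpotent_vrestr (U : {vspace W}) f :
  (f @: U <= U)%VS -> nilpotent_end f -> nilpotent_end (vrestr U f).
Proof.
by move=> fU [N fN0]; exists N => u; apply: subvs_inj; rewrite iter_vrestr // fN0.
Qed.

Lemma dim_lker_vrestr (U : {vspace W}) f k : (f @: U <= U)%VS ->
  \dim (lker (lfun_iter k (vrestr U f))) = \dim (U :&: lker (lfun_iter k f)).
Proof.
move=> fU.
rewrite -(limg_dim_eq (f := linfun (@vsval K W U))); last first.
  apply/eqP; rewrite -subv0; apply/subvP => u; rewrite memv_cap memv0 => /andP[_].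
  by rewrite memv_ker lfunE /= => /eqP u0; apply/eqP/subvs_inj; rewrite u0 linear0.
congr (\dim _); apply/vspaceP => v; apply/memv_imgP/idP => [[u uk ->]|].
  rewrite lfunE /= memv_cap subvsP; apply/lker_lfun_iterP.
  by rewrite -iter_vrestr // (lker_lfun_iterP _ _ _ uk) linear0.
rewrite memv_cap => /andP[Uv vk]; exists (vsproj U v); last by rewrite lfunE /= vsprojK.
apply/lker_lfun_iterP/subvs_inj; rewrite iter_vrestr // vsprojK // linear0.
exact: lker_lfun_iterP.
Qed.

Lemma iter_vquot_end (Z : {vspace W}) f k w : (f @: Z <= Z)%VS ->
  iter k (vquot_end Z f) (vquot_pi Z w) = vquot_pi Z (iter k f w).
Proof. by move=> fZ; elim: k => //= k ->; rewrite vquot_endE. Qed.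

Lemma nilpotent_vquot_end (Z : {vspace W}) f :
  (f @: Z <= Z)%VS -> nilpotent_end f -> nilpotent_end (vquot_end Z f).
Proof.
move=> fZ [N fN0]; exists N => u.
by rewrite -[u]vquot_reprK iter_vquot_end // fN0 linear0.
Qed.

Lemma dim_lker_vquot_end (Z : {vspace W}) f k : (f @: Z <= Z)%VS ->
  (\dim (lker (lfun_iter k (vquot_end Z f))) + \dim Z
    = \dim (lfun_iter k f @^-1: Z))%N.
Proof.
move=> fZ; rewrite -(limg_ker_dim (vquot_pi Z) (_ @^-1: Z)) lker_vquot_pi addnC.
have iterZ w : w \in Z -> iter k f w \in Z.
  by move=> Zw; elim: k => //= k IH; apply: (subvP fZ); apply: memv_img.
congr (_ + _)%N; congr (\dim _).
  apply/esym/capv_idPr/subvP => w Zw; rewrite -memv_preim lfun_iterE; exact: iterZ.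
have kE w : (vquot_pi Z w \in lker (lfun_iter k (vquot_end Z f)))
    = (lfun_iter k f w \in Z).
  by rewrite memv_ker lfun_iterE iter_vquot_end // -lfun_iterE -memv_ker lker_vquot_pi.
apply/vspaceP => u; apply/idP/memv_imgP => [uk|[w wZ ->]].
  exists (vquot_repr Z u); last by rewrite vquot_reprK.
  by rewrite -memv_preim -kE vquot_reprK.
by rewrite kE memv_preim.
Qed.

End SubQuotientKernels.

(** * Kernel dimensions on sl(V) and psl(V) *)

Section KernelDimensions.

Variables (K : fieldType) (V : vectType K) (p a l : nat) (s : seq nat) (e : 'End(V)).
Hypothesis Kp : p \in [pchar K].
Hypotheses (es : jordan_type e s) (qs : all (dvdn (p ^ a)) s).
Hypotheses (sl_ : l \in s) (npl : ~~ (p ^ a.+1 %| l)%N).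

Let pp : prime p := pcharf_prime Kp.
Let q0 : (0 < p ^ a)%N. Proof. by rewrite expn_gt0 prime_gt0. Qed.

Lemma lfun_trace_id : lfun_trace (\1%VF : 'End(V)) = (\dim {:V})%:R.
Proof. by rewrite /lfun_trace mxof1 ?mxtrace1 // (basis_free (vbasisP _)). Qed.

Lemma ad_neq_id k w : (p ^ a <= k)%N -> iter k (ad_fun e) w != \1%VF.
Proof.
move=> qk; apply/eqP => ew; have ql := allP qs _ sl_.
have [x [xq /eqP]] := ad_kernel_trace_neq0 Kp es sl_ ql npl; apply.
by apply: lfun_trace_ker_ad ew _; rewrite -(subnK qk) iterD xq iter_ad0.
Qed.

(** Rank-nullity for the trace restricted to ker ad(e)^k: its image is K if q <= k, and 0
    otherwise. *)
Lemma dim_lker_ad_sl k :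
  (\dim (lker (lfun_iter k (ad_sl e))) + (p ^ a <= k)
    = \dim (lker (lfun_iter k (ad_gl e))))%N.
Proof.
rewrite dim_lker_vrestr ?ad_gl_sl //.
rewrite -(limg_ker_dim (linfun (@lfun_trace K V)) (lker _)) -/(sl V) capvC.
congr (_ + _)%N; case: leqP => [qk|kq].
  have [x [xq x0]] := ad_kernel_trace_neq0 Kp es sl_ (allP qs _ sl_) npl.
  suff -> : (linfun (@lfun_trace K V) @: lker (lfun_iter k (ad_gl e)) = <[1 : K^o]>)%VS.
    by rewrite dim_vline oner_eq0.
  apply/eqP; rewrite eqEsubv; apply/andP; split.
    apply/subvP => c _; rewrite -[c]mulr1; exact: (memvZ (c : K) (memv_line (1 : K^o))).
  rewrite -memvE -[1](mulVf x0) -[_ * _]/(_ *: (_ : K^o)) memvZ //.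
  apply/memv_imgP; exists x; last by rewrite lfunE.
  by apply/lker_lfun_iterP; rewrite iter_ad_gl -(subnK qk) iterD xq iter_ad0.
suff -> : (linfun (@lfun_trace K V) @: lker (lfun_iter k (ad_gl e)) = 0)%VS.
  by rewrite dimv0.
have [w [ew _]] := ad_preim_id Kp es qs.
apply/eqP; rewrite -subv0; apply/subvP => _ /memv_imgP[x /lker_lfun_iterP xk ->].
rewrite memv0 lfunE /=; apply/eqP; apply: lfun_trace_ker_ad ew _.
rewrite -(prednK q0) ltnS in kq.
by rewrite -(subnK kq) iterD -[iter k _ _]iter_ad_gl xk iter_ad0.
Qed.

Lemma Zsl_eq0 : ~~ (p %| \dim {:V})%N -> Zsl V = 0%VS.
Proof.
move=> npn; apply/eqP; rewrite -subv0; apply/subvP => u.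
rewrite -memv_preim lfunE /= => /vlineP[c uc].
have := subvsP u; rewrite uc mem_sl linearZ /= lfun_trace_id.
rewrite -[_ *: _]/(_ * _) mulf_eq0 -(dvdn_pcharf Kp) (negPf npn) orbF => /eqP c0.
by rewrite memv0; apply/eqP/subvs_inj; rewrite uc c0 scale0r linear0.
Qed.

Lemma dim_lker_ad_psl_ndvd k : ~~ (p %| \dim {:V})%N ->
  \dim (lker (lfun_iter k (ad_psl e))) = \dim (lker (lfun_iter k (ad_sl e))).
Proof.
move=> npn; have := dim_lker_vquot_end k (ad_sl_Zsl e).
set F := lfun_iter k (ad_sl e).
have -> : \dim (Zsl V) = 0%N by rewrite (Zsl_eq0 npn) dimv0.
by rewrite addn0 => ->; rewrite (Zsl_eq0 npn) lpreim0.
Qed.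

(** Here the centre is a line. Its preimage under the k-th power F is one dimension larger than ker
    F exactly when the line lies in the image of F, that is, when k < q. *)
Lemma dim_lker_ad_psl_dvd k : (p %| \dim {:V})%N ->
  (\dim (lker (lfun_iter k (ad_psl e))) + (p ^ a <= k)
    = \dim (lker (lfun_iter k (ad_sl e))))%N.
Proof.
move=> pn.
have sl1 : \1%VF \in sl V by rewrite mem_sl lfun_trace_id -(dvdn_pcharf Kp).
pose z := vsproj (sl V) \1%VF; have zE : vsval z = \1%VF by rewrite vsprojK.
have Zz : Zsl V = <[z]>%VS.
  apply/vspaceP => u; rewrite -memv_preim lfunE /=.
  apply/vlineP/vlineP => -[c uc]; exists c; last by rewrite uc linearZ /= zE.
  by apply: subvs_inj; rewrite linearZ /= zE.
have n0 : \1%VF != 0 :> 'End(V).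
  have := ad_neq_id 0 (leqnn _); rewrite iter_ad0; apply: contraNneq => ->; exact: eqxx.
have z0 : z != 0 by apply: contraNneq n0 => z0; rewrite -zE z0 linear0.
have valF j u : vsval (iter j (ad_sl e) u) = iter j (ad_fun e) (vsval u).
  by rewrite iter_vrestr ?ad_gl_sl // iter_ad_gl.
have := dim_lker_vquot_end k (ad_sl_Zsl e); rewrite -/(ad_psl e).
move: (\dim (lker (lfun_iter k (ad_psl e)))) => m.
set F := lfun_iter k (ad_sl e).
rewrite -(limg_ker_dim F (F @^-1: _)).
have -> : (F @^-1: Zsl V :&: lker F = lker F)%VS.
  apply/capv_idPr/subvP => u; rewrite memv_ker -memv_preim => /eqP ->; exact: mem0v.
rewrite Zz dim_vline z0.
suff -> : \dim (F @: (F @^-1: <[z]>)) = (k < p ^ a)%N by case: leqP => _; lia.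
case: (ltnP k (p ^ a)%N) => [kq|qk].
  suff -> : (F @: (F @^-1: <[z]>) = <[z]>)%VS by rewrite dim_vline z0.
  have [w [ew wa]] := ad_preim_id Kp es qs.
  (* A preimage of 1 must be found inside sl(V). For k < q - 1 this one is a commutator; for k = q -
     1 it is w, of trace 0 if a > 0 and equal to 1, of trace n = 0 in K, if a = 0. *)
  have slw : iter ((p ^ a).-1 - k) (ad_fun e) w \in sl V.
    rewrite mem_sl; case: (_ - _)%N => [|j]; last first.
      by rewrite iterS /ad_fun linearB /= lfun_traceC subrr.
    case: (posnP a) ew => [-> /= ->|a0 _]; last by rewrite /= wa.
    by rewrite lfun_trace_id -(dvdn_pcharf Kp).
  have zF : F (vsproj (sl V) (iter ((p ^ a).-1 - k) (ad_fun e) w)) = z.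
    apply: subvs_inj; rewrite lfun_iterE valF zE vsprojK // -iterD subnKC ?ew //.
    by rewrite -ltnS prednK.
  apply/eqP; rewrite eqEsubv; apply/andP; split.
    by apply/subvP => _ /memv_imgP[u uz ->]; rewrite memv_preim.
  by rewrite -memvE -{1}zF; apply: memv_img; rewrite -memv_preim zF memv_line.
suff -> : (F @: (F @^-1: <[z]>) = 0)%VS by rewrite dimv0.
apply/eqP; rewrite -subv0; apply/subvP => _ /memv_imgP[u + ->].
rewrite -memv_preim => /vlineP[c Fu]; rewrite memv0 Fu; apply: contraT => cz.
have c0 : c != 0 by apply: contraNneq cz => ->; rewrite scale0r.
have := ad_neq_id (vsval (c^-1 *: u)) qk.
have Fz : F (c^-1 *: u) = z by rewrite linearZ /= Fu scalerA mulVf // scale1r.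
by rewrite -valF -lfun_iterE -/F Fz zE eqxx.
Qed.

End KernelDimensions.

(** * From kernel dimensions to block counts *)

Lemma block_shift1 (r r' : nat -> nat) :
    (forall m, (0 < m)%N -> r' m + (m == 1) = r m + (m.+1 == 1))%N ->
  (r' 1 + 1 = r 1)%N /\ (forall m, (1 <= m)%N -> m <> 1%N -> r' m = r m).
Proof.
move=> D; split=> [|m m0 m1]; first by rewrite D ?addn0.
by have := D m m0; lia.
Qed.

Lemma block_shift (r r' : nat -> nat) q : (1 < q)%N ->
    (forall m, (0 < m)%N -> r' m + (m == q) = r m + (m.+1 == q))%N ->
  [/\ r' (q - 1)%N = (r (q - 1)%N).+1, (r' q + 1 = r q)%N
    & forall m, (1 <= m)%N -> m <> q -> m <> (q - 1)%N -> r' m = r m].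
Proof.
case: q => [|[|q]] // _ D; rewrite subn1 /=; split=> [||m m0 mq mq1].
- by have := D q.+1 isT; lia.
- by have := D q.+2 isT; lia.
by have := D m m0; lia.
Qed.

Theorem theorem1p2 (K : closedFieldType) (p : nat) (hp : p \in [pchar K])
    (V : vectType K) (n : nat) (hn : (2 <= n)%N) (hV : \dim {:V} = n)
    (e : 'End(V)) (he : e \in sl V) (hnil : nilpotent_end e)
    (t : nat) (ht : (1 <= t)%N) (d : 'I_t -> nat) (hd : forall r, (1 <= d r)%N)
    (hed : jordan_type e [seq d r | r <- enum 'I_t]) :
  let alpha := logn p (\big[gcdn/0%N]_(r < t) d r) in
  let e0 := ad_gl e in
  let e0' := ad_sl e in
  let e0'' := ad_psl e in
  [/\
      (alpha = 0)%N ->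
        (jblocks 1 e0' : int) = (jblocks 1 e0 : int) - 1 /\
        (forall m : nat, (1 <= m)%N -> m <> 1%N -> jblocks m e0' = jblocks m e0),
      (0 < alpha)%N ->
        [/\ jblocks (p ^ alpha - 1) e0' = 1%N,
            (jblocks (p ^ alpha) e0' : int) = (jblocks (p ^ alpha) e0 : int) - 1
          & forall m : nat, (1 <= m)%N ->
              m <> (p ^ alpha)%N -> m <> (p ^ alpha - 1)%N ->
              jblocks m e0' = jblocks m e0],
      ~~ (p %| n)%N ->
        (jblocks 1 e0'' : int) = (jblocks 1 e0 : int) - 1 /\
        (forall m : nat, (1 <= m)%N -> m <> 1%N -> jblocks m e0'' = jblocks m e0),
      (p %| n)%N -> (alpha = 0)%N ->
        (jblocks 1 e0'' : int) = (jblocks 1 e0 : int) - 2 /\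
        (forall m : nat, (1 <= m)%N -> m <> 1%N -> jblocks m e0'' = jblocks m e0)
    &
      (p %| n)%N -> (0 < alpha)%N ->
        [/\ (jblocks (p ^ alpha) e0'' : int) = (jblocks (p ^ alpha) e0 : int) - 2,
            jblocks (p ^ alpha - 1) e0'' = 2%N
          & forall m : nat, (1 <= m)%N ->
              m <> (p ^ alpha)%N -> m <> (p ^ alpha - 1)%N ->
              jblocks m e0'' = jblocks m e0]].
Proof.
have pp := pcharf_prime hp.
set g := \big[gcdn/0%N]_(r < t) d r; move=> alpha e0 e0' e0''.
have g_dvd r : (g %| d r)%N by rewrite /g (bigD1 r) //= dvdn_gcdl.
have g0 : (0 < g)%N by apply: dvdn_gt0 (hd (Ordinal ht)) (g_dvd _).
set s := [seq d r | r <- enum 'I_t] in hed.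
have qs : all (dvdn (p ^ alpha)) s.
  by apply/allP => _ /mapP[r _ ->]; apply: dvdn_trans (pfactor_dvdnn p g) (g_dvd r).
(* If p^(alpha+1) divided every block size it would divide their gcd. *)
have [l sl_ npl] : exists2 l, l \in s & ~~ (p ^ alpha.+1 %| l)%N.
  have : ~~ [forall r, p ^ alpha.+1 %| d r]%N.
    apply: contraTN isT => /forallP pd; suff : (p ^ alpha.+1 %| g)%N.
      by rewrite pfactor_dvdn // ltnn.
    by apply/dvdn_biggcdP => r _.
  by case/forallPn => r npr; exists (d r) => //; apply: map_f; rewrite mem_enum.
have q0 : (0 < p ^ alpha)%N by rewrite expn_gt0 prime_gt0.
have n0 : nilpotent_end e0 := ad_nilpotent hnil.
have n1 : nilpotent_end e0' := nilpotent_vrestr (ad_gl_sl e) n0.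
have n2 : nilpotent_end e0'' := nilpotent_vquot_end (ad_sl_Zsl e) n1.
have k01 := dim_lker_ad_sl hp hed qs sl_ npl.
have k12 := dim_lker_ad_psl_ndvd e hp.
have k12p := dim_lker_ad_psl_dvd hp hed qs sl_ npl.
rewrite hV -/e0 -/e0' -/e0'' in k01 k12 k12p.
have J0 m := jblocks_dim_lker (m := m) n0.
have J1 m := jblocks_dim_lker (m := m) n1.
have J2 m := jblocks_dim_lker (m := m) n2.
have q_pred : (0 < alpha)%N -> jblocks (p ^ alpha - 1) e0 = 0%N.
  move=> a0; have q1 : (1 < p ^ alpha)%N by rewrite -(exp1n alpha) ltn_exp2r ?prime_gt1.
  have js := jordan_type_jblocks n0; apply/eqP; rewrite -leqn0 leqNgt -has_count has_pred1.
  apply/negP => /(allP (dvdn_jordan_type_ad hp hed js qs)) /dvdn_leq; lia.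
(* Contrapositively, p not dividing n forces alpha = 0, which reduces the third case to the
   first. *)
have dvd_n : (0 < alpha)%N -> (p %| n)%N.
  move=> a0; rewrite -hV (dim_jordan_type hed); elim: (s) qs => //= l' s' IH /andP[ql /IH].
  by apply: dvdn_add; apply: dvdn_trans ql; apply: dvdn_exp.
set q := (p ^ alpha)%N in k01 k12p q0 q_pred *.
have D1 m : (0 < m)%N ->
    (jblocks m e0' + (m == q) = jblocks m e0 + (m.+1 == q))%N.
  move=> m0; have := J0 m m0; have := J1 m m0.
  by rewrite -!k01; case: m m0 => //= m _; lia.
have D2 : (p %| n)%N -> forall m, (0 < m)%N ->
    (jblocks m e0'' + (m == q) = jblocks m e0' + (m.+1 == q))%N.
  move=> pn m m0; have := J1 m m0; have := J2 m m0.
  by rewrite -!k12p //; case: m m0 => //= m _; lia.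
have D2n m : ~~ (p %| n)%N -> (0 < m)%N -> jblocks m e0'' = jblocks m e0'.
  move=> pn m0; have := J1 m m0; have := J2 m m0.
  by rewrite !k12 //; lia.
have eq1 : alpha = 0%N -> q = 1%N by rewrite /q => ->.
have lt1 : (0 < alpha)%N -> (1 < q)%N.
  by move=> a0; rewrite -(exp1n alpha) ltn_exp2r ?prime_gt1.
split.
- move=> /eq1 q1; rewrite q1 in D1; have [h1 h] := block_shift1 D1.
  by split=> //; rewrite -h1 PoszD addrK.
- move=> a0; have [hp1 hq h] := block_shift (lt1 a0) D1.
  by split=> //; rewrite ?hp1 ?q_pred // -hq PoszD addrK.
- move=> pn; have a0 : alpha = 0%N by apply/eqP; rewrite -leqn0 leqNgt; apply: contra pn.
  rewrite (eq1 a0) in D1; have [h1 h] := block_shift1 D1.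
  by split=> [|m m0 m1]; rewrite D2n //; [rewrite -h1 PoszD addrK | apply: h].
- move=> pn a0; have {}D2 := D2 pn; rewrite (eq1 a0) in D1 D2.
  have [h1 h] := block_shift1 D1; have [h1' h'] := block_shift1 D2.
  by split=> [|m m0 m1]; [rewrite -h1 -h1' -addnA PoszD addrK | rewrite h' ?h].
move=> pn a0; have {}D2 := D2 pn; have q1 := lt1 a0.
have [hp1 hq h] := block_shift q1 D1; have [hp1' hq' h'] := block_shift q1 D2.
split=> [||m m0 mq mq1]; last by rewrite h' ?h.
  by rewrite -hq -hq' -addnA PoszD addrK.
by rewrite hp1' hp1 q_pred.
Qed.
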